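(* Let $\mathcal{K}$ be the set of all vectors $k=(k_1,\dots,k_n)\in\{\pm1\}^n$, with $n\ge 2$, for which: (i) $k_{n-1}=-1$ and $k_n=1$; and (ii) $n=2$, or $n\ge 3$ and $k_j=k_{n-j-1}$ for $1\le j\le n-2$ (so that $(k_1,\dots,k_{n-2})$ is a palindrome). Then the set $\mathcal{S}$ is given by $\mathcal{S}=\{p_k:k\in\mathcal{K}\}$. Moreover, if $k\in\mathcal{K}$ has length $n$, then $p_k(\lambda)=\lambda\, q_{k(1:n-2)}(\lambda)$.
   Context: For $k=(k_1,\dots,k_n)\in\{\pm1\}^n$ and $1\le i\le j\le n$, let $k(i:j):=(k_i,\dots,k_j)$ and let $q_{k(i:j)}(\lambda)$ be the determinant of the tridiagonal matrix of order $j-i+2$ with all main diagonal entries equal to $\lambda$, all entries on the first superdiagonal equal to $1$, and first subdiagonal entries $k_i,k_{i+1},\dots,k_j$ (from top to bottom). Further set $q_{k(i:j)}(\lambda):=\lambda$ if $i-j=1$, $:=1$ if $i-j=2$, and $:=0$ if $i-j=3$. For $n\in\mathbb{N}$ and $k\in\{\pm1\}^n$ the polynomial $p_k$ (monic, of degree $n$) is defined by $(-1)^n p_k(\lambda)=q_{k(1:n-1)}(-\lambda)-k_n\,q_{k(2:n-2)}(-\lambda)$. $\mathcal{S}$ denotes the set of those polynomials $p_k$, with $k=(k_1,\dots,k_n)\in\{\pm1\}^n$ for some $n\ge2$, for which: (i) $k_{n-1}=-1$ and $k_n=1$; (ii) $p_k=p_{\widehat k}$, where $\widehat k\in\{\pm1\}^n$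 is identical to $k$ but with the last two entries interchanged, so that $\widehat k_{n-1}=1$, $\widehat k_n=-1$. *)

(* Defs.v *)
From HB Require Import structures.
From mathcomp Require Import all_boot all_order all_algebra.
From mathcomp Require Import classical_sets.

Set Implicit Arguments.
Unset Strict Implicit.
Unset Printing Implicit Defensive.

Import Order.TTheory GRing.Theory Num.Theory.

Local Open Scope classical_set_scope.
Local Open Scope ring_scope.

(* A vector k = (k_1, ..., k_n) is a sequence of size n; entry k i is the
   1-based k_i (only meaningful for 1 <= i <= n). *)
Definition entry (R : numDomainType) (k : seq R) (i : nat) : R :=
  nth 0 k i.-1.

Definition sign_vector (R : numDomainType) (k : seq R) : Prop :=
  forall x, x \in k -> x = 1 \/ x = -1.

(* Rows and columns are numbered from 0, so the first subdiagonal entry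
   in column c is k_(i + c). *)
Definition tridiag (R : numDomainType) (k : seq R) (i m : nat) :
    'M[{poly R}]_m :=
  \matrix_(r < m, c < m)
    if (r == c :> nat) then 'X
    else if (c == r.+1 :> nat) then 1
    else if (r == c.+1 :> nat) then (entry k (i + c))%:P
    else 0.

(* q_{k(i:j)}; the right end j is an integer because j = -1 occurs (in p_k
   for n = 1). The value is irrelevant when i - j > 3. *)
Definition qpol (R : numDomainType) (k : seq R) (i : nat) (j : int) :
    {poly R} :=
  if i%:Z - j == 1 then 'X
  else if i%:Z - j == 2 then 1
  else if i%:Z - j == 3 then 0
  else \det (tridiag k i (absz (j - i%:Z + 2))).

Definition ppol (R : numDomainType) (k : seq R) : {poly R} :=
  let n := size k in
  (-1) ^+ n *: ((qpol k 1 (n%:Z - 1)) \Po (- 'X)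
                - entry k n *: ((qpol k 2 (n%:Z - 2)) \Po (- 'X))).

Definition swap_last (R : numDomainType) (k : seq R) : seq R :=
  let n := size k in
  mkseq (fun a => if a.+1 == n.-1 then entry k n
                  else if a.+1 == n then entry k n.-1
                  else entry k a.+1) n.

Definition calS (R : numDomainType) : set {poly R} :=
  [set ppol k | k in [set k : seq R |
    [/\ sign_vector k, (2 <= size k)%N,
        entry k (size k).-1 = -1 /\ entry k (size k) = 1
      & ppol k = ppol (swap_last k)]]].

Definition calK (R : numDomainType) : set (seq R) :=
  [set k : seq R |
    [/\ sign_vector k, (2 <= size k)%N,
        entry k (size k).-1 = -1 /\ entry k (size k) = 1
      & size k = 2%N \/
        ((3 <= size k)%N /\
         forall j : nat, (1 <= j <= size k - 2)%N ->
           entry k j = entry k (size k - j - 1)%N)]].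

Arguments calS : clear implicits.
Arguments calK : clear implicits.

(* Main.v *)
Require Import Defs.
From mathcomp Require Import all_boot all_order all_algebra.
From mathcomp Require Import classical_sets.
From mathcomp Require Import zify ring.

Set Implicit Arguments.
Unset Strict Implicit.
Unset Printing Implicit Defensive.

Import GRing.Theory Num.Theory.

Local Open Scope classical_set_scope.
Local Open Scope ring_scope.

(** Expanding along the last row, with [D i m] the tridiagonal determinant of
    order [m] starting at [k_i], one finds
    [p_k = 'X * D 1 n.-1 - k_(n-1) D 1 (n-2) - k_n D 2 (n-2)]; hence for
    [k_(n-1) = -1], [k_n = 1] condition (ii) says [D 1 (n-2) = D 2 (n-2)], and
    then [p_k = 'X * D 1 n.-1].  A palindrome satisfies this because [D] is
    invariant under reversal of its entries.  Conversely, comparing the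
    expansions of [D] along the first and the last row, the equality descends
    to smaller orders as in the Euclidean algorithm, and since every [D] is
    monic each descent step yields one of the equations [k_j = k_(n-j-1)]. *)

Section Continuant.
Variables (R : numDomainType) (k : seq R).
Implicit Types i m : nat.

Local Notation D i m := (\det (tridiag k i m)).

Lemma det_tridiag0 i : D i 0 = 1.
Proof. exact: det_mx00. Qed.

Lemma det_tridiag1 i : D i 1 = 'X.
Proof. by rewrite det_mx11 mxE eqxx. Qed.

Lemma det_tridiag_first i m :
  D i m.+2 = 'X * D i.+1 m.+1 - entry k i *: D i.+2 m.
Proof.
rewrite (expand_det_row _ ord0) 2!big_ord_recl big1 => [|c _]; last first.
  by rewrite mxE /= mul0r.
rewrite addr0 !mxE /= mul1r /cofactor /= expr0 expr1 mul1r mulN1r.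
congr ('X * \det _ - _).
  apply/matrixP => r c; rewrite !mxE /= /bump /= !add1n !eqSS.
  by rewrite addnS addSn.
(* Without row 0 and column 1, the first column can be nonzero only in its top entry [entry k i]. *)
rewrite (expand_det_col _ ord0) big_ord_recl big1 => [|r _]; last first.
  by rewrite !mxE /= mul0r.
rewrite addr0 !mxE /= addn0 mul_polyC /cofactor /= expr0 mul1r.
congr (_ *: \det _).
apply/matrixP => r c; rewrite !mxE /= /bump /= !add1n !eqSS.
by rewrite !addnS !addSn.
Qed.

(** Strong induction: expanding along the first row leaves shorter determinants, to which the
    last-row rule applies, and the two expansions commute. *)
Lemma det_tridiag_last i m :
  D i m.+2 = 'X * D i m.+1 - entry k (i + m) *: D i m.
Proof.
have [b] := ubnP m; elim: b i m => // b IH i [|[|m]] lt_mb.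
- by rewrite det_tridiag_first !det_tridiag1 !det_tridiag0 addn0.
- rewrite !det_tridiag_first !det_tridiag1 !det_tridiag0 addn1 -!mul_polyC.
  by ring.
- rewrite det_tridiag_first [in LHS](IH i.+1) // [in LHS](IH i.+2); last lia.
  rewrite (det_tridiag_first i m.+1) (det_tridiag_first i m).
  rewrite !addSn !addnS -!mul_polyC.
  by ring.
Qed.

Lemma det_tridiag_monic i m : size (D i m) = m.+1 /\ D i m \is monic.
Proof.
have [b] := ubnP m; elim: b i m => // b IH i [|[|m]] lt_mb.
- by rewrite det_tridiag0 size_poly1 monic1.
- by rewrite det_tridiag1 size_polyX monicX.
have [sz1 mon1] := IH i.+1 m.+1 lt_mb.
have [sz2 _] := IH i.+2 m (ltnW lt_mb).
have szX : size ('X * D i.+1 m.+1) = m.+3.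
  by rewrite mulrC size_mulX ?monic_neq0 ?sz1.
have lt_sz : (size (- (entry k i *: D i.+2 m))%R < size ('X * D i.+1 m.+1)%R)%N.
  rewrite szX size_polyN (leq_ltn_trans (size_scale_leq _ _)) // sz2; lia.
by rewrite det_tridiag_first size_polyDl // szX monicE lead_coefDl //
           -monicE monicMl // monicX.
Qed.

(** This parity removes the substitution of [- 'X] from [ppol]. *)
Lemma det_tridiag_comp_oppX i m : D i m \Po (- 'X) = (-1) ^+ m *: D i m.
Proof.
have [b] := ubnP m; elim: b i m => // b IH i [|[|m]] lt_mb.
- by rewrite det_tridiag0 comp_polyC expr0 scale1r.
- by rewrite det_tridiag1 comp_polyX expr1 scaleN1r.
- rewrite det_tridiag_first comp_polyB comp_polyM comp_polyX comp_polyZ.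
  rewrite (IH _ m.+1) // (IH _ m) 1?ltnW // !exprS !mulN1r opprK.
  by rewrite scaleNr mulrNN scalerBr scalerAr !scalerA [entry k i * _]mulrC.
Qed.

(** The first-row recurrence for the entries is the last-row recurrence for the reversed ones. Order
    [m] involves [m - 1] entries, whence the bound on [t]. *)
Lemma det_tridiag_rev i i' m :
  (forall t, (t.+1 < m)%N -> entry k (i + t) = entry k (i' + (m - 2 - t))) ->
  D i m = D i' m.
Proof.
have [b] := ubnP m; elim: b i i' m => // b IH i i' [|[|m]] lt_mb eq_k.
- by rewrite !det_tridiag0.
- by rewrite !det_tridiag1.
rewrite det_tridiag_first (det_tridiag_last i').
have := eq_k 0 isT; rewrite addn0 !subSS !subn0 => ->.
rewrite (IH i.+1 i' m.+1) // ?(IH i.+2 i' m) //; first exact: ltnW.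
- move=> t lt_tm; have -> : (i.+2 + t = i + t.+2)%N by lia.
  by rewrite eq_k; last lia; congr (entry k _); lia.
- move=> t lt_tm; have -> : (i.+1 + t = i + t.+1)%N by lia.
  by rewrite eq_k; last lia; congr (entry k _); lia.
Qed.

(** With one side expanded along its last row and the other along its first, the ['X] terms cancel.
    What remains are scaled monic polynomials: their scalars agree and, being nonzero, can be
    cancelled. *)
Lemma det_tridiag_descent i j m :
    entry k i != 0 ->
    D j m.+2 = D i m.+2 -> D j m.+1 = D i.+1 m.+1 ->
  entry k i = entry k (j + m) /\ D j m = D i.+2 m.
Proof.
rewrite det_tridiag_last det_tridiag_first => k_neq0 + eq1; rewrite eq1.
move=> /addrI /oppr_inj eq2.
have lc l m' : lead_coef (D l m') = 1.
  by apply/monicP; have [] := det_tridiag_monic l m'.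
have := congr1 lead_coef eq2; rewrite !lead_coefZ !lc !mulr1 => eq_k.
split=> //; apply/eqP; rewrite -subr_eq0.
have /eqP : entry k i *: (D j m - D i.+2 m) = 0.
  by rewrite scalerBr -[in X in X - _]eq_k eq2 subrr.
by rewrite -mul_polyC mulf_eq0 polyC_eq0 (negPf k_neq0).
Qed.

Lemma det_tridiag_palindrome N :
    (forall j, (1 <= j <= N)%N -> entry k j != 0) ->
  D 1 N = D 2 N <->
  (forall j, (1 <= j <= N)%N -> entry k j = entry k (N.+1 - j)).
Proof.
move=> k_neq0; split=> [eqD | pal]; last first.
  (* [D 1 N] carries k_1, ..., k_(N-1) and [D 2 N] carries k_2, ..., k_N; for a palindrome these are
     reversals of each other. *)
  apply: det_tridiag_rev => t lt_tN; rewrite pal; last lia.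
  by congr (entry k _); lia.
(* As in the Euclidean algorithm, a pair of equalities in consecutive orders is carried down; at
   [j = 0] it is a triviality and the hypothesis. *)
have eqDj j : (j <= N)%N ->
    D 1 (N.+1 - j) = D j.+1 (N.+1 - j) /\ D 1 (N - j) = D j.+2 (N - j).
  elim: j => [|j IH] lt_jN; first by rewrite !subn0.
  have [eq1 eq2] := IH (ltnW lt_jN).
  rewrite subSS; split=> //.
  have := @det_tridiag_descent j.+1 1 (N - j.+1)%N.
  have -> : ((N - j.+1).+2 = N.+1 - j)%N by lia.
  have -> : ((N - j.+1).+1 = N - j)%N by lia.
  by case=> //; apply: k_neq0; lia.
case=> [|j] // lt_jN.
have [eq1 eq2] := eqDj j (ltnW lt_jN).
have := @det_tridiag_descent j.+1 1 (N - j.+1)%N.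
have -> : ((N - j.+1).+2 = N.+1 - j)%N by lia.
have -> : ((N - j.+1).+1 = N - j)%N by lia.
case=> // [|-> _]; first exact: k_neq0.
by congr (entry k _); lia.
Qed.

(** The conventions for [i - j] equal to 1 and 2 are the determinants of orders 1 and 0. *)
Lemma qpol_det i m (j : int) : j = i%:Z + m%:Z - 2 -> qpol k i j = D i m.
Proof.
move=> ->; rewrite /qpol.
case: m => [|[|m]].
- by rewrite det_tridiag0; do 2?[case: eqP => ?; try lia].
- by rewrite det_tridiag1; case: eqP => ?; try lia.
do 3![case: eqP => ?; first lia].
by congr (\det (tridiag k i _)); lia.
Qed.

Lemma ppol_det n : size k = n.+2 ->
  ppol k = 'X * D 1 n.+1 - entry k n.+1 *: D 1 n - entry k n.+2 *: D 2 n.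
Proof.
move=> szk; rewrite /ppol szk.
rewrite (@qpol_det 1 n.+2); last lia.
rewrite (@qpol_det 2 n); last lia.
(* The orders [n.+2] and [n] have the parity of [size k], so all signs cancel. *)
rewrite !det_tridiag_comp_oppX det_tridiag_last add1n.
rewrite 2!exprS mulrA mulrNN mul1r mul1r scalerA [entry k n.+2 * _]mulrC.
by rewrite -scalerA -scalerBr scalerA -expr2 sqrr_sign scale1r.
Qed.

End Continuant.

Section SwapLast.
Variables (R : numDomainType) (k : seq R) (n : nat).
Hypothesis szk : size k = n.+2.

Lemma size_swap_last : size (swap_last k) = n.+2.
Proof. by rewrite size_mkseq. Qed.

Lemma entry_swap_last j : (1 <= j <= n.+2)%N ->
  entry (swap_last k) j = if j == n.+1 then entry k n.+2
                          else if j == n.+2 then entry k n.+1 else entry k j.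
Proof.
by case: j => // j le_jn; rewrite /entry /swap_last nth_mkseq szk //=; lia.
Qed.

(** The last entry involved has index [i + m - 2], at most [n], hence lies before the swapped
    positions. *)
Lemma det_tridiag_swap_last i m : (1 <= i)%N -> (i + m <= n.+2)%N ->
  \det (tridiag (swap_last k) i m) = \det (tridiag k i m).
Proof.
move=> i_gt0 le_imn; congr (\det _); apply/matrixP => r c; rewrite !mxE.
case: eqP => // _; case: eqP => // _; case: eqP => // rE.
have := ltn_ord r; rewrite rE => lt_cm.
rewrite entry_swap_last; last lia.
by do 2![case: eqP => [?|_]; first lia].
Qed.

Lemma ppol_swap_last :
  ppol (swap_last k) = 'X * \det (tridiag k 1 n.+1)
    - entry k n.+2 *: \det (tridiag k 1 n)
    - entry k n.+1 *: \det (tridiag k 2 n).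
Proof.
rewrite (ppol_det size_swap_last) !det_tridiag_swap_last //.
by rewrite !entry_swap_last ?ltnS ?leqnn ?leqnSn // eqxx eqn_leq ltnn eqxx.
Qed.

End SwapLast.

Section Main.
Variables (R : numDomainType) (k : seq R) (n : nat).
Hypotheses (szk : size k = n.+2).
Hypotheses (kn1 : entry k n.+1 = -1) (kn2 : entry k n.+2 = 1).

Lemma ppol_eq_swap_last :
  ppol k = ppol (swap_last k) <->
  \det (tridiag k 1 n) = \det (tridiag k 2 n).
Proof.
rewrite (ppol_swap_last szk) (ppol_det szk) kn1 kn2 !scaleN1r !scale1r !opprK.
split=> [|->]; last by rewrite addrK subrK.
set P := 'X * _; set A := \det _; set B := \det _ => eq_p.
(* The two polynomials are [P + A - B] and [P - A + B]; the factor 2 is cancelled in characteristic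
   zero. *)
have /eqP : (A - B) *+ 2 = 0.
  by rewrite -(subrr (P + A - B)) {2}eq_p mulr2n; ring.
by rewrite -mulr_natr mulf_eq0 -polyC_natr polyC_eq0 pnatr_eq0 orbF
           subr_eq0 => /eqP.
Qed.

Lemma ppol_mulX :
  \det (tridiag k 1 n) = \det (tridiag k 2 n) ->
  ppol k = 'X * qpol k 1 n%:Z.
Proof.
move=> eqD; rewrite (ppol_det szk) kn1 kn2 scaleN1r scale1r opprK eqD addrK.
by rewrite (@qpol_det _ _ 1 n.+1) //; lia.
Qed.

Lemma calK_det_tridiag : sign_vector k ->
  calK R k <-> \det (tridiag k 1 n) = \det (tridiag k 2 n).
Proof.
move=> sgn.
have k_neq0 j : (1 <= j <= n)%N -> entry k j != 0.
  move=> lt_jn; have /sgn[] : entry k j \in k by rewrite mem_nth // szk; lia.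
  - by move=> ->; rewrite oner_neq0.
  - by move=> ->; rewrite oppr_eq0 oner_neq0.
rewrite det_tridiag_palindrome //.
have indexE j : (n.+2 - j - 1 = n.+1 - j)%N by lia.
split=> [[_ _ _ []]|pal].
- by rewrite szk => -[n0] j; rewrite n0; lia.
- case=> _; rewrite szk subn2 /= => pal j lt_jn.
  by rewrite pal // indexE.
split; rewrite ?szk //; case: (posnP n) => [->|n_gt0]; [by left|right].
by split=> // j; rewrite subn2 indexE; apply: pal.
Qed.

End Main.

Theorem proposition3p3 (R : numDomainType) :
  calS R = [set ppol k | k in calK R] /\
  (forall k : seq R, calK R k ->
     ppol k = 'X * qpol k 1 ((size k)%:Z - 2)).
Proof.
split=> [|k kK].
  (* Already the two sets of vectors coincide, not only their images. *)
  rewrite /calS; congr image; apply/seteqP; split=> k.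
  - case=> sgn sz2; case szk: (size k) sz2 => [|[|n]] //= _ [kn1 kn2].
    by move=> /(ppol_eq_swap_last szk kn1 kn2)/(calK_det_tridiag szk kn1 kn2 sgn).
  - move=> kK; have [sgn sz2 ends _] := kK.
    split=> //; case szk: (size k) sz2 ends => [|[|n]] //= _ [kn1 kn2].
    apply/(ppol_eq_swap_last szk kn1 kn2).
    exact/(calK_det_tridiag szk kn1 kn2 sgn).
have [sgn sz2 ends _] := kK.
case szk: (size k) sz2 ends => [|[|n]] //= _ [kn1 kn2].
have -> : n.+2%:Z - 2 = n%:Z by lia.
exact/ppol_mulX/(calK_det_tridiag szk kn1 kn2 sgn).
Qed.
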